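(* Let $J\colon\mathcal S_n\to\mathbb R$ be strictly isotone and let Assumption (A1) hold. If the linear fusion rule $(\boldsymbol K_1^\ast,\boldsymbol K_2^\ast,\hat{\boldsymbol P}^\ast)\in\mathcal K_H$ is $J$-optimal over $\mathcal K_H$, then it is $J$-optimal (i.e. a solution of problem (OF)).
   Context: $n,p_1,p_2$ are positive integers, $p_1,p_2\le n$, $H_1\in\mathbb R^{p_1\times n}$, $H_2\in\mathbb R^{p_2\times n}$, $H=\begin{pmatrix}H_1\\H_2\end{pmatrix}$. Assumption (A1): $\mathrm{rk}(H_1)=p_1$, $\mathrm{rk}(H_2)=p_2$, $\mathrm{rk}(H)=n$ (and the two input estimators $\hat x_1,\hat x_2$ are unbiased estimators of $H_1x_{\rm true}$, $H_2x_{\rm true}$; in the deterministic maps below only their values enter). $\mathcal S_m,\mathcal P_m^\succ$: real symmetric, resp. positive definite, $m\times m$ matrices; $\preceq,\prec$ refer to the Löwner order. $\mathcal D_F:=\mathbb R^{p_1}\times\mathbb R^{p_2}\times\mathcal P_{p_1}^\succ\times\mathcal P_{p_2}^\succ$, with points denoted $(\hat x_1,\hat x_2,\hat P_1,\hat P_2)$. Statements about maps on $\mathcal D_F$ are read pointwise. $J$ is strictly isotone if $A\preceq B$ implies $J(A)\le J(B)$ and ($A\preceq B$, $A\ne B$) implies $J(A)<J(B)$, for all $A,B\in\mathcal S_n$. $\mathcal F_H$ is the set of maps (linear fusion rules) $(\boldsymbol K_1,\boldsymbol K_2,\hat{\boldsymbol P})\colon\mathcal D_F\to\mathbb R^{n\times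 p_1}\times\mathbb R^{n\times p_2}\times\mathcal P_n^\succ$ that are unbiased, i.e. $\boldsymbol K_1H_1+\boldsymbol K_2H_2=I$ on $\mathcal D_F$, and preserve conservativeness on $\mathcal P_{p_1+p_2}^\succ$, i.e. for all $(\hat x_1,\hat x_2,\hat P_1,\hat P_2)\in\mathcal D_F$ and all $P_{\rm joint}=\begin{pmatrix}P_1&P_{12}\\P_{12}^\top&P_2\end{pmatrix}\in\mathcal P_{p_1+p_2}^\succ$ with $P_1\preceq\hat P_1$ and $P_2\preceq\hat P_2$ one has $\begin{pmatrix}\boldsymbol K_1&\boldsymbol K_2\end{pmatrix}P_{\rm joint}\begin{pmatrix}\boldsymbol K_1&\boldsymbol K_2\end{pmatrix}^\top\preceq\hat{\boldsymbol P}$. $\mathcal K_H^{\boldsymbol\alpha}$ denotes the set of all functions $\boldsymbol\alpha\colon\mathcal D_F\to[0,1]$ such that, at each point of $\mathcal D_F$: $\boldsymbol\alpha=0$ if $H_2^\top\hat P_2^{-1}H_2\succ H_1^\top\hat P_1^{-1}H_1$; $\boldsymbol\alpha\in[0,1]$ is arbitrary if $H_2^\top\hat P_2^{-1}H_2=H_1^\top\hat P_1^{-1}H_1$; $\boldsymbol\alpha=1$ if $H_2^\top\hat P_2^{-1}H_2\prec H_1^\top\hat P_1^{-1}H_1$; and otherwise $\boldsymbol\alpha\in[0,1]$ is such that $\boldsymbol\alpha H_1^\top\hat P_1^{-1}H_1+(1-\boldsymbol\alpha)H_2^\top\hat P_2^{-1}H_2$ is non-singular. For $\boldsymbol\alpha\in\mathcal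 K_H^{\boldsymbol\alpha}$ define $\hat{\boldsymbol P}^{\boldsymbol\alpha}:=(\boldsymbol\alpha H_1^\top\hat P_1^{-1}H_1+(1-\boldsymbol\alpha)H_2^\top\hat P_2^{-1}H_2)^{-1}$, $\boldsymbol K_1^{\boldsymbol\alpha}:=\boldsymbol\alpha\hat{\boldsymbol P}^{\boldsymbol\alpha}H_1^\top\hat P_1^{-1}$, $\boldsymbol K_2^{\boldsymbol\alpha}:=(1-\boldsymbol\alpha)\hat{\boldsymbol P}^{\boldsymbol\alpha}H_2^\top\hat P_2^{-1}$. The Kahan-Uhlmann family is $\mathcal K_H:=\{(\boldsymbol K_1^{\boldsymbol\alpha},\boldsymbol K_2^{\boldsymbol\alpha},\hat{\boldsymbol P}^{\boldsymbol\alpha}) : \boldsymbol\alpha\in\mathcal K_H^{\boldsymbol\alpha}\}$. An element $(\boldsymbol K_1^\ast,\boldsymbol K_2^\ast,\hat{\boldsymbol P}^\ast)$ of $\mathcal F_H$ (resp. $\mathcal K_H$) is $J$-optimal, i.e. a solution of problem (OF) (resp. $J$-optimal over $\mathcal K_H$), if $J(\hat{\boldsymbol P}^\ast)\le J(\hat{\boldsymbol P})$ at every point of $\mathcal D_F$ for every $(\boldsymbol K_1,\boldsymbol K_2,\hat{\boldsymbol P})$ in $\mathcal F_H$ (resp. $\mathcal K_H$). *)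

(* Defs.v *)
From mathcomp Require Import all_boot all_order all_algebra.
From mathcomp Require Import classical_sets reals.

Set Implicit Arguments.
Unset Strict Implicit.
Unset Printing Implicit Defensive.

Import Order.TTheory GRing.Theory Num.Theory.

Local Open Scope classical_set_scope.
Local Open Scope ring_scope.

Section Loewner.
Context {R : realType} {m : nat}.
Implicit Types A B : 'M[R]_m.

Definition psdmx A : Prop :=
  A \is symmetricmx /\ forall x : 'cV[R]_m, 0 <= (x^T *m A *m x) 0 0.

Definition pdmx A : Prop :=
  A \is symmetricmx /\
  forall x : 'cV[R]_m, x != 0 -> 0 < (x^T *m A *m x) 0 0.

Definition loewner_le A B : Prop := psdmx (B - A).
Definition loewner_lt A B : Prop := pdmx (B - A).

(* The domain of J is the space of symmetric matrices; the values of the total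
   function J outside of it are unconstrained. *)
Definition strictly_isotone (J : 'M[R]_m -> R) : Prop :=
  forall A B, A \is symmetricmx -> B \is symmetricmx ->
    (loewner_le A B -> J A <= J B) /\
    (loewner_le A B -> A <> B -> J A < J B).

End Loewner.

Record fusion_input (R : realType) (p1 p2 : nat) := FusionInput {
  xhat1 : 'cV[R]_p1;
  xhat2 : 'cV[R]_p2;
  Phat1 : 'M[R]_p1;
  Phat2 : 'M[R]_p2;
  Phat1_pd : pdmx Phat1;
  Phat2_pd : pdmx Phat2
}.

(* Positive definiteness of the values of Phat is not part of this record; it
   is required by fusion_rules below. *)
Record linear_fusion_rule (R : realType) (n p1 p2 : nat) := LinearFusionRule {
  K1 : fusion_input R p1 p2 -> 'M[R]_(n, p1);
  K2 : fusion_input R p1 p2 -> 'M[R]_(n, p2);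
  Phat : fusion_input R p1 p2 -> 'M[R]_n
}.

Section Fusion.
Context {R : realType} {n p1 p2 : nat}.
Variables (H1 : 'M[R]_(p1, n)) (H2 : 'M[R]_(p2, n)).
Implicit Types (d : fusion_input R p1 p2) (r : linear_fusion_rule R n p1 p2).

Definition unbiased r : Prop :=
  forall d, K1 r d *m H1 + K2 r d *m H2 = 1%:M.

Definition preserves_conservativeness r : Prop :=
  forall d (P1 : 'M[R]_p1) (P12 : 'M[R]_(p1, p2)) (P2 : 'M[R]_p2),
    let Pjoint := block_mx P1 P12 P12^T P2 in
    let K := row_mx (K1 r d) (K2 r d) in
    pdmx Pjoint -> loewner_le P1 (Phat1 d) -> loewner_le P2 (Phat2 d) ->
    loewner_le (K *m Pjoint *m K^T) (Phat r d).

Definition fusion_rules : set (linear_fusion_rule R n p1 p2) :=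
  [set r | [/\ forall d, pdmx (Phat r d), unbiased r &
               preserves_conservativeness r]].

Definition info1 d : 'M[R]_n := H1^T *m invmx (Phat1 d) *m H1.
Definition info2 d : 'M[R]_n := H2^T *m invmx (Phat2 d) *m H2.

Definition KU_info (a : fusion_input R p1 p2 -> R) d : 'M[R]_n :=
  a d *: info1 d + (1 - a d) *: info2 d.

Definition KU_weights : set (fusion_input R p1 p2 -> R) :=
  [set a | forall d,
    [/\ 0 <= a d <= 1,
        loewner_lt (info1 d) (info2 d) -> a d = 0,
        loewner_lt (info2 d) (info1 d) -> a d = 1 &
        ~ loewner_lt (info1 d) (info2 d) ->
        info2 d <> info1 d ->
        ~ loewner_lt (info2 d) (info1 d) ->
        KU_info a d \in unitmx]].

Definition KU_rule (a : fusion_input R p1 p2 -> R) :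
    linear_fusion_rule R n p1 p2 :=
  let P d := invmx (KU_info a d) in
  {| K1 := fun d => a d *: (P d *m H1^T *m invmx (Phat1 d));
     K2 := fun d => (1 - a d) *: (P d *m H2^T *m invmx (Phat2 d));
     Phat := P |}.

Definition KU_family : set (linear_fusion_rule R n p1 p2) :=
  [set KU_rule a | a in KU_weights].

End Fusion.

Definition optimal_over {R : realType} {n p1 p2 : nat} (J : 'M[R]_n -> R)
    (F : set (linear_fusion_rule R n p1 p2))
    (r : linear_fusion_rule R n p1 p2) : Prop :=
  F r /\ forall r', F r' -> forall d, J (Phat r d) <= J (Phat r' d).

(* Main.v *)
Require Import Defs.
From mathcomp Require Import all_boot all_order all_algebra.
From mathcomp Require Import boolp classical_sets reals.
From mathcomp Require Import ring lra.

Set Implicit Arguments.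
Unset Strict Implicit.
Unset Printing Implicit Defensive.

Import Order.TTheory GRing.Theory Num.Theory.

Local Open Scope ring_scope.

(** Fix a point d of the domain and write I1, I2 for the information matrices
    H1^T Phat1^-1 H1 and H2^T Phat2^-1 H2.  The theorem holds because, at d,
    every fusion rule is dominated in the Loewner order by a member of the
    Kahan-Uhlmann family, and that family consists of fusion rules.

    Domination.  Let a fusion rule have value P at d.  For a nonzero vector x,
    let c be the larger of x^T I1 x and x^T I2 x, positive since H has full
    column rank.  The rank-one matrix (Hx)(Hx)^T / c has
    diagonal blocks below Phat1 and Phat2, so up to a perturbation making it
    definite it is an admissible joint covariance; unbiasedness (KH = 1) maps
    it to x x^T / c, and conservativeness yields x x^T <= c P, that is
    x^T P^-1 x <= max(x^T I1 x, x^T I2 x) ([fusion_rule_info_bound]).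
    A theorem of the alternative for two quadratic forms, due to Yuan
    ([yuan_alternative]), replaces the pointwise maximum by a single convex
    combination: P^-1 <= t I1 + (1 - t) I2 for some t in [0,1].  When I1 and I2
    are strictly ordered, t may be moved to the end point which the definition
    of the family prescribes, since that only increases the right-hand side.
    Inversion reverses the order, so the rule with weight t at d (and any
    admissible weight elsewhere) has a value below P
    ([KU_rule_below_fusion_rule]).

    Membership.  The combination M = al I1 + (1 - al) I2 is positive definite
    for every admissible weight.  The quadratic form of K Pjoint K^T
    at y is that of Pjoint at the convex combination of (u, 0) and (0, v), with
    u = Phat1^-1 H1 M^-1 y and v = Phat2^-1 H2 M^-1 y; convexity bounds it by
    the form of M at M^-1 y, i.e. by y^T M^-1 y, whatever the
    cross-covariance is ([KU_rule_fusion_rule]).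

    Isotonicity of J then transfers both facts to the costs. *)

(** * Bilinear forms of matrices *)

Definition bform {R : realType} {m n : nat} (A : 'M[R]_(m, n))
  (x : 'cV[R]_m) (y : 'cV[R]_n) : R := (x^T *m A *m y) 0 0.

Notation qform A x := (bform A x x).

Section BilinearForms.
Context {R : realType}.
Implicit Types (m n p : nat) (a : R).

Lemma symmetricmxP n (A : 'M[R]_n) : reflect (A^T = A) (A \is symmetricmx).
Proof.
rewrite is_hermitianmxE expr0 scale1r map_mx_id // eq_sym; exact: eqP.
Qed.

Lemma bformDl m n (A : 'M[R]_(m, n)) x1 x2 y :
  bform A (x1 + x2) y = bform A x1 y + bform A x2 y.
Proof. by rewrite /bform linearD !mulmxDl mxE. Qed.

Lemma bformDr m n (A : 'M[R]_(m, n)) x y1 y2 :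
  bform A x (y1 + y2) = bform A x y1 + bform A x y2.
Proof. by rewrite /bform mulmxDr mxE. Qed.

Lemma bformZl m n (A : 'M[R]_(m, n)) a x y :
  bform A (a *: x) y = a * bform A x y.
Proof. by rewrite /bform linearZ /= -!scalemxAl mxE. Qed.

Lemma bformZr m n (A : 'M[R]_(m, n)) a x y :
  bform A x (a *: y) = a * bform A x y.
Proof. by rewrite /bform -scalemxAr mxE. Qed.

Lemma bformNl m n (A : 'M[R]_(m, n)) x y : bform A (- x) y = - bform A x y.
Proof. by rewrite -scaleN1r bformZl mulN1r. Qed.

Lemma bformNr m n (A : 'M[R]_(m, n)) x y : bform A x (- y) = - bform A x y.
Proof. by rewrite -scaleN1r bformZr mulN1r. Qed.

Lemma bformD m n (A B : 'M[R]_(m, n)) x y :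
  bform (A + B) x y = bform A x y + bform B x y.
Proof. by rewrite /bform mulmxDr mulmxDl mxE. Qed.

Lemma bformZ m n a (A : 'M[R]_(m, n)) x y :
  bform (a *: A) x y = a * bform A x y.
Proof. by rewrite /bform -scalemxAr -scalemxAl mxE. Qed.

Lemma bformB m n (A B : 'M[R]_(m, n)) x y :
  bform (A - B) x y = bform A x y - bform B x y.
Proof. by rewrite -scaleN1r bformD bformZ mulN1r. Qed.

Lemma bformMl m n p (A : 'M[R]_(m, n)) (C : 'M[R]_(m, p)) x y :
  bform A (C *m x) y = bform (C^T *m A) x y.
Proof. by rewrite /bform trmx_mul !mulmxA. Qed.

Lemma bformMr m n p (A : 'M[R]_(m, n)) (C : 'M[R]_(n, p)) x y :
  bform A x (C *m y) = bform (A *m C) x y.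
Proof. by rewrite /bform !mulmxA. Qed.

Lemma qform_congr m n (A : 'M[R]_m) (C : 'M[R]_(m, n)) x :
  qform (C^T *m A *m C) x = qform A (C *m x).
Proof. by rewrite bformMl bformMr. Qed.

Lemma bform_tr m n (A : 'M[R]_(m, n)) x y : bform A^T y x = bform A x y.
Proof.
transitivity ((x^T *m A *m y)^T 0 0); last by rewrite mxE.
by rewrite !trmx_mul trmxK mulmxA.
Qed.

Lemma bformC n (A : 'M[R]_n) x y :
  A \is symmetricmx -> bform A x y = bform A y x.
Proof. by move=> /symmetricmxP AT; rewrite -bform_tr AT. Qed.

Lemma qformN n (A : 'M[R]_n) x : qform A (- x) = qform A x.
Proof. by rewrite bformNl bformNr opprK. Qed.

Lemma bform_block m n (A : 'M[R]_m) (B : 'M[R]_(m, n)) C (D : 'M[R]_n)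
    u v u' v' :
  bform (block_mx A B C D) (col_mx u v) (col_mx u' v') =
  bform A u u' + bform B u v' + (bform C v u' + bform D v v').
Proof.
rewrite /bform tr_col_mx mul_row_block mul_row_col !mulmxDl !mxE.
by rewrite addrACA.
Qed.

Lemma qform_rank1 n (z x : 'cV[R]_n) :
  qform (z *m z^T) x = (bform 1%:M x z) ^+ 2.
Proof.
have -> : bform (z *m z^T) x x = (bform 1%:M x z) * (bform 1%:M z x).
  by rewrite /bform !mulmx1 !mulmxA -mulmxA mxE big_ord1.
by rewrite -[bform 1%:M z x]bform_tr trmx1 expr2.
Qed.

End BilinearForms.

(** * Definiteness and the Loewner order *)

Section Definiteness.
Context {R : realType} {n : nat}.
Implicit Types (A B P : 'M[R]_n) (x y z : 'cV[R]_n) (a c t : R).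

Lemma pdmx_psd A : pdmx A -> psdmx A.
Proof.
move=> [As Apos]; split=> // x; have [->|x0] := eqVneq x 0.
  by rewrite mulmx0 mxE.
exact: ltW (Apos x x0).
Qed.

Lemma loewner_leP A B : A \is symmetricmx -> B \is symmetricmx ->
  loewner_le A B <-> forall x, qform A x <= qform B x.
Proof.
move=> As Bs; split=> [[_ AB] x|AB].
  by have := AB x; rewrite -/(bform _ x x) bformB subr_ge0.
split=> [|x]; last by rewrite -/(bform _ x x) bformB subr_ge0.
apply/symmetricmxP; rewrite linearB /=.
by rewrite (symmetricmxP _ As) (symmetricmxP _ Bs).
Qed.

Lemma loewner_le_qform A B x : loewner_le A B -> qform A x <= qform B x.
Proof. by case=> _ /(_ x); rewrite -/(bform _ x x) bformB subr_ge0. Qed.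

Lemma loewner_le_trans A B P : loewner_le A B -> loewner_le B P -> loewner_le A P.
Proof.
move=> [/symmetricmxP ABs AB] [/symmetricmxP BPs BP].
have e : P - A = (P - B) + (B - A) by rewrite addrA subrK.
split=> [|x]; first by apply/symmetricmxP; rewrite e linearD /= ABs BPs.
by rewrite -/(bform _ x x) e bformD addr_ge0 ?(BP x) ?(AB x).
Qed.

Lemma psdmx_congr m A (C : 'M[R]_(n, m)) : psdmx A -> psdmx (C^T *m A *m C).
Proof.
move=> [/symmetricmxP As Apos].
split; first by apply/symmetricmxP; rewrite !trmx_mul trmxK As mulmxA.
by move=> x; rewrite -/(bform _ x x) qform_congr Apos.
Qed.

Lemma loewner_le_congr m A B (C : 'M[R]_(m, n)) : loewner_le A B ->
  loewner_le (C *m A *m C^T) (C *m B *m C^T).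
Proof.
by move=> /(psdmx_congr C^T); rewrite trmxK mulmxBr mulmxBl.
Qed.

Lemma pdmx_qform_eq0 A x : pdmx A -> qform A x <= 0 -> x = 0.
Proof.
by move=> [_ Apos] Ax; apply/eqP/negPn/negP => /Apos; rewrite ltNge Ax.
Qed.

Lemma psdmx_cauchy_schwarz A x y : psdmx A ->
  (bform A x y) ^+ 2 <= qform A x * qform A y.
Proof.
move=> [As Apos].
have q s : 0 <= qform A x + 2 * s * bform A x y + s ^+ 2 * qform A y.
  have := Apos (x + s *: y); rewrite -/(bform _ _ _).
  rewrite bformDl !bformDr !bformZl !bformZr (bformC y x As); lra.
(* minimise the quadratic q over s; it is affine when qform A y vanishes *)
have := Apos y; rewrite -/(bform A y y) le_eqVlt => /predU1P[y0|y_gt0].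
  rewrite -y0 mulr0; have [->|b0] := eqVneq (bform A x y) 0; first by rewrite expr0n.
  have := q (- (qform A x + 1) / (2 * bform A x y)); rewrite -y0.
  have -> : 2 * (- (qform A x + 1) / (2 * bform A x y)) * bform A x y
            = - (qform A x + 1) by field.
  lra.
have := q (- bform A x y / qform A y).
have -> : qform A x + 2 * (- bform A x y / qform A y) * bform A x y +
  (- bform A x y / qform A y) ^+ 2 * qform A y =
  (qform A x * qform A y - bform A x y ^+ 2) / qform A y.
  by field; rewrite gt_eqF.
by rewrite pmulr_lge0 ?invr_gt0 // subr_ge0.
Qed.

Lemma unitmx_kerP A : (forall x, A *m x = 0 -> x = 0) -> A \in unitmx.
Proof.
move=> Ainj; rewrite -unitmx_tr -row_free_unit -kermx_eq0.
apply/rowV0P => v /sub_kermxP vA.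
by apply: trmx_inj; rewrite trmx0; apply: Ainj; rewrite -(trmxK A) -trmx_mul vA trmx0.
Qed.

Lemma pdmx_unit A : pdmx A -> A \in unitmx.
Proof.
move=> [_ Apos]; apply: unitmx_kerP => x Ax.
by apply/eqP/negPn/negP => /Apos; rewrite -mulmxA Ax mulmx0 mxE ltxx.
Qed.


Lemma pdmx1 : pdmx (1%:M : 'M[R]_n).
Proof.
split; first by apply/symmetricmxP; rewrite trmx1.
move=> x x0; rewrite mulmx1 mxE lt_neqAle sumr_ge0 ?andbT; last first.
  by move=> i _; rewrite mxE -expr2 sqr_ge0.
apply: contra x0; rewrite eq_sym psumr_eq0; last first.
  by move=> i _; rewrite mxE -expr2 sqr_ge0.
move=> /allP x0; apply/eqP/colP => i; rewrite mxE.
by have := x0 i (mem_index_enum i); rewrite mxE -expr2 sqrf_eq0 => /eqP.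
Qed.

(** If [qform A x = 0], Cauchy-Schwarz makes [x] orthogonal for [A] to every
    vector, in particular to [invmx A *m x], which gives [x^T x = 0]. *)
Lemma psdmx_unit_pd A : psdmx A -> A \in unitmx -> pdmx A.
Proof.
move=> Apsd Au; have [As Apos] := Apsd; split=> // x x0.
rewrite lt_neqAle Apos andbT; apply/negP => /eqP qx.
have := psdmx_cauchy_schwarz (invmx A *m x) x Apsd.
rewrite [qform A x]/bform -qx mulr0 bformMl trmx_inv (symmetricmxP _ As).
rewrite mulVmx //; have := pdmx1.2 x x0; rewrite -/(bform _ x x); nra.
Qed.

Lemma invmx_sym A : A \is symmetricmx -> invmx A \is symmetricmx.
Proof.
by move=> /symmetricmxP As; apply/symmetricmxP; rewrite trmx_inv As.
Qed.

Lemma qform_invmx A x : pdmx A -> qform A (invmx A *m x) = qform (invmx A) x.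
Proof.
move=> Apd; rewrite bformMl bformMr (symmetricmxP _ (invmx_sym Apd.1)).
by rewrite mulVmx ?mul1mx //; exact: pdmx_unit.
Qed.

Lemma pdmx_inv A : pdmx A -> pdmx (invmx A).
Proof.
move=> Apd; have [As Apos] := Apd; have Au := pdmx_unit Apd.
split=> [|x x0]; first exact: invmx_sym.
have x'0 : invmx A *m x != 0.
  by apply: contra x0 => /eqP e; rewrite -(mulKVmx Au x) e mulmx0.
by have := Apos _ x'0; rewrite -!/(bform _ _ _) qform_invmx.
Qed.

(** Both directions are Cauchy-Schwarz for the inner product of [P], as
    [y^T z] is the product of [y] with [invmx P *m z]. *)
Lemma loewner_le_rank1 P z c : pdmx P -> 0 <= c ->
  loewner_le (z *m z^T) (c *: P) <-> qform (invmx P) z <= c.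
Proof.
move=> Ppd c0; have Pu := pdmx_unit Ppd; have Ps := Ppd.1.
have zzs : z *m z^T \is symmetricmx.
  by apply/symmetricmxP; rewrite trmx_mul trmxK.
have cPs : c *: P \is symmetricmx.
  by apply/symmetricmxP; rewrite linearZ /= (symmetricmxP _ Ps).
have swap x : bform 1%:M x z = bform P x (invmx P *m z).
  by rewrite bformMr mulmxV.
rewrite loewner_leP //; split=> [le_c|le_c x].
  (* the test vector at which Cauchy-Schwarz is an equality *)
  have := le_c (invmx P *m z).
  rewrite qform_rank1 bformZ swap qform_invmx //.
  have := (pdmx_psd (pdmx_inv Ppd)).2 z; rewrite -/(bform _ z z).
  by nra.
rewrite qform_rank1 bformZ swap.
apply: le_trans (psdmx_cauchy_schwarz _ _ (pdmx_psd Ppd)) _.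
rewrite qform_invmx // mulrC ler_wpM2r //; exact: (pdmx_psd Ppd).2.
Qed.

(** Expanding the nonnegative value of [qform A] at
    [invmx B *m y - invmx A *m y] and bounding its first term by [qform B]
    leaves exactly the claimed inequality at [y]. *)
Lemma loewner_le_inv A B : pdmx A -> pdmx B -> loewner_le A B ->
  loewner_le (invmx B) (invmx A).
Proof.
move=> Apd Bpd AB; have Au := pdmx_unit Apd; have Bu := pdmx_unit Bpd.
have [Ais _] := pdmx_inv Apd; have [Bis _] := pdmx_inv Bpd.
apply/loewner_leP => // y.
have := (pdmx_psd Apd).2 (invmx B *m y - invmx A *m y); rewrite -/(bform _ _ _).
rewrite bformDl !bformDr !bformNl !bformNr.
have -> : bform A (invmx A *m y) (invmx B *m y) = qform (invmx B) y.
  by rewrite bformMl bformMr (symmetricmxP _ Ais) mulVmx // mul1mx.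
have -> : bform A (invmx B *m y) (invmx A *m y) = qform (invmx B) y.
  by rewrite bformMl bformMr (symmetricmxP _ Bis) -mulmxA mulmxV // mulmx1.
rewrite qform_invmx //.
have := loewner_le_qform (invmx B *m y) AB.
rewrite qform_invmx //; lra.
Qed.

(** The defect is [t * (1 - t) * qform A (x - y)]. *)
Lemma qform_convex A x y t : psdmx A -> 0 <= t <= 1 ->
  qform A (t *: x + (1 - t) *: y) <= t * qform A x + (1 - t) * qform A y.
Proof.
move=> [As Apos] /andP[t0 t1].
have := Apos (x - y); rewrite -/(bform _ _ _).
rewrite !bformDl !bformDr !bformNl !bformNr !bformZl !bformZr (bformC y x As).
move=> qxy; have := mulr_ge0 (mulr_ge0 t0 (_ : 0 <= 1 - t)) qxy.
by rewrite subr_ge0 => /(_ t1); lra.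
Qed.

End Definiteness.

Lemma pdmx_block_diag {R : realType} {m n : nat} (A : 'M[R]_m) (B : 'M[R]_n) :
  pdmx A -> pdmx B -> pdmx (block_mx A 0 0 B).
Proof.
move=> Apd Bpd; split.
  apply/symmetricmxP; rewrite tr_block_mx !trmx0.
  by rewrite (symmetricmxP _ Apd.1) (symmetricmxP _ Bpd.1).
move=> w; rewrite -[w]vsubmxK col_mx_eq0 negb_and -/(bform _ _ _) bform_block.
have b0 k l a b : bform (0 : 'M[R]_(k, l)) a b = 0.
  by rewrite /bform mulmx0 mul0mx mxE.
rewrite !b0 addr0 add0r => /orP[] w0.
  by rewrite ltr_wpDr //; [exact: (pdmx_psd Bpd).2|exact: Apd.2].
by rewrite ltr_wpDl //; [exact: (pdmx_psd Apd).2|exact: Bpd.2].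
Qed.

(** * Yuan's theorem of the alternative *)

Section Yuan.
Context {R : realType} {n : nat}.
Variables (A B : 'M[R]_n).
Hypotheses (As : A \is symmetricmx) (Bs : B \is symmetricmx).
Hypothesis AB_max : forall x, 0 <= Num.max (qform A x) (qform B x).

(** After replacing [y] by [- y] if needed, the cross term of [M] is nonpositive,
    so [M] stays negative along the whole segment from [x] to [y].  The forms
    of [A] and [B] change order along that segment, hence agree somewhere,
    and there they agree with [M] too: both are negative. *)
Lemma no_negative_crossing t (M := t *: A + (1 - t) *: B) x y :
  0 <= qform A x -> qform M x < 0 -> 0 <= qform B y -> qform M y < 0 ->
  0 <= t <= 1 -> False.
Proof.
move=> Ax Mx By My t01.
wlog Mxy : y By My / bform M x y <= 0.
  move=> H; have [b0|/ltW b0] := leP (bform M x y) 0; first exact: (H y).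
  by apply: (H (- y)); rewrite ?qformN // bformNr oppr_le0.
have Ms : M \is symmetricmx.
  apply/symmetricmxP; rewrite linearD !linearZ /=.
  by rewrite (symmetricmxP _ As) (symmetricmxP _ Bs).
have Ds : B - A \is symmetricmx.
  by apply/symmetricmxP; rewrite linearB /= (symmetricmxP _ As) (symmetricmxP _ Bs).
pose z s : 'cV[R]_n := (1 - s) *: x + s *: y.
have qz (N : 'M[R]_n) s : N \is symmetricmx -> qform N (z s) =
    (1 - s) ^+ 2 * qform N x + 2 * s * (1 - s) * bform N x y + s ^+ 2 * qform N y.
  move=> Ns; rewrite bformDl !bformDr !bformZl !bformZr (bformC y x Ns); ring.
have ME u : qform M u = t * qform A u + (1 - t) * qform B u.
  by rewrite bformD !bformZ.
(* the form of [B - A] along the segment, as a polynomial, so that the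
   intermediate value theorem for polynomials applies *)
pose p : {poly R} := (1 - 'X) ^+ 2 * (qform (B - A) x)%:P +
  'X * (1 - 'X) * (2 * bform (B - A) x y)%:P + 'X ^+ 2 * (qform (B - A) y)%:P.
have pE s : p.[s] = qform (B - A) (z s).
  rewrite qz // /p !hornerE /=; ring.
have : p.[0] <= 0 <= p.[1].
  rewrite !pE !qz // !bformB; apply/andP; split.
    by rewrite ME in Mx; nra.
  by rewrite ME in My; nra.
move=> /(poly_ivt ler01)[s /andP[s0 s1]]; rewrite rootE pE bformB subr_eq0 => /eqP BA.
have := AB_max (z s); rewrite BA maxxx.
have : qform M (z s) < 0.
  rewrite qz //.
  have hx : (1 - s) ^+ 2 * qform M x <= 0.
    by rewrite mulr_ge0_le0 ?sqr_ge0 // ltW.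
  have hxy : s * (1 - s) * bform M x y <= 0.
    by rewrite mulr_ge0_le0 ?mulr_ge0 ?subr_ge0.
  have [-> | s_neq0] := eqVneq s 0; first by lra.
  have : s ^+ 2 * qform M y < 0 by rewrite pmulr_rlt0 ?exprn_even_gt0.
  lra.
by rewrite ME BA -mulrDl addrC subrK mul1r => /lt_geF ->.
Qed.

(** Only the vectors at which one of the two forms is negative constrain [t]:
    those with [B] negative bound it from below by [f], those with [A] negative
    bound it from above.  By [no_negative_crossing] every lower bound
    is at most every upper bound, so the supremum of the lower bounds works. *)
Lemma yuan_alternative : exists2 t, 0 <= t <= 1 &
  forall x, 0 <= qform (t *: A + (1 - t) *: B) x.
Proof.
pose f x := - qform B x / (qform A x - qform B x).
(* 0 is adjoined so that the set is nonempty and its supremum nonnegative *)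
pose E := [set t | t = 0 \/ exists x, [/\ 0 <= qform A x, qform B x < 0 & t = f x]]%classic.
have Eub u : 0 <= u -> (forall x, 0 <= qform A x -> qform B x < 0 -> f x <= u) ->
    ubound E u.
  by move=> u0 fu _ [->//|[x [Ax Bx ->]]]; apply: fu.
have f1 x : 0 <= qform A x -> qform B x < 0 -> f x <= 1.
  by move=> Ax Bx; rewrite ler_pdivrMr; lra.
have supub : ubound E (sup E).
  by apply: ub_le_sup; exists 1; apply: Eub.
have E0 : (E !=set0)%classic by exists 0; left.
exists (sup E); first by rewrite supub ?ge_sup //; [apply: Eub|left].
move=> z; rewrite bformD !bformZ.
have t0 : 0 <= sup E by apply: supub; left.
have t1 : sup E <= 1 by apply: ge_sup => //; apply: Eub.
have [Az|Az] := leP 0 (qform A z); have [Bz|Bz] := leP 0 (qform B z).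
- by nra.
- have : f z <= sup E by apply: supub; right; exists z.
  rewrite ler_pdivrMr; lra.
- pose g := qform B z / (qform B z - qform A z).
  have dz : 0 < qform B z - qform A z by lra.
  have g01 : 0 <= g <= 1 by rewrite divr_ge0 ?ler_pdivrMr //; lra.
  suff : sup E <= g by rewrite ler_pdivlMr //; lra.
  apply: ge_sup => //; apply: Eub => [|x Ax Bx]; first by case/andP: g01.
  rewrite leNgt; apply/negP => gf.
  have := f1 x Ax Bx => fx1.
  have dx : 0 < qform A x - qform B x by lra.
  (* a weight strictly between the bounds, at which both forms are negative *)
  pose t := (g + f x) / 2.
  have gt : g < t by rewrite /t; lra.
  have tf : t < f x by rewrite /t; lra.
  apply: (@no_negative_crossing t x z) => //.
  + by move: tf; rewrite ltr_pdivlMr // bformD !bformZ; lra.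
  + by move: gt; rewrite ltr_pdivrMr // bformD !bformZ; lra.
  + lra.
- by have := AB_max z; rewrite leNgt gt_max Az Bz.
Qed.

End Yuan.

(** * Information matrices and the Kahan-Uhlmann family *)

Section Fusion.
Context {R : realType} {n p1 p2 : nat}.
Variables (H1 : 'M[R]_(p1, n)) (H2 : 'M[R]_(p2, n)).
Hypothesis rk_H : \rank (col_mx H1 H2) = n.
Implicit Types (d : fusion_input R p1 p2) (r : linear_fusion_rule R n p1 p2)
  (x : 'cV[R]_n).

Lemma col_mx_inj x : H1 *m x = 0 -> H2 *m x = 0 -> x = 0.
Proof.
move=> x1 x2; apply: trmx_inj; rewrite trmx0; apply/eqP.
have Hfree : row_free (col_mx H1 H2)^T by rewrite /row_free mxrank_tr rk_H.
rewrite -(mulmx_free_eq0 _ Hfree) -trmx_mul mul_col_mx x1 x2 col_mx0.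
by rewrite trmx0.
Qed.

Lemma info1E d x : qform (info1 H1 d) x = qform (invmx (Phat1 d)) (H1 *m x).
Proof. exact: qform_congr. Qed.

Lemma info2E d x : qform (info2 H2 d) x = qform (invmx (Phat2 d)) (H2 *m x).
Proof. exact: qform_congr. Qed.

Lemma info1_psd d : psdmx (info1 H1 d).
Proof. exact: psdmx_congr (pdmx_psd (pdmx_inv (Phat1_pd d))). Qed.

Lemma info2_psd d : psdmx (info2 H2 d).
Proof. exact: psdmx_congr (pdmx_psd (pdmx_inv (Phat2_pd d))). Qed.

Lemma info_max_gt0 d x : x != 0 ->
  0 < Num.max (qform (info1 H1 d) x) (qform (info2 H2 d) x).
Proof.
move=> x0; rewrite lt_max; apply/negPn/negP; rewrite negb_or -!leNgt.
rewrite info1E info2E => /andP[q1 q2]; case/eqP: x0; apply: col_mx_inj.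
  exact: pdmx_qform_eq0 (pdmx_inv (Phat1_pd d)) q1.
exact: pdmx_qform_eq0 (pdmx_inv (Phat2_pd d)) q2.
Qed.

Lemma KU_infoE (al : fusion_input R p1 p2 -> R) d x :
  qform (KU_info H1 H2 al d) x =
  al d * qform (info1 H1 d) x + (1 - al d) * qform (info2 H2 d) x.
Proof. by rewrite bformD !bformZ. Qed.

Lemma KU_info_psd (al : fusion_input R p1 p2 -> R) d :
  0 <= al d <= 1 -> psdmx (KU_info H1 H2 al d).
Proof.
move=> /andP[a0 a1]; have [/symmetricmxP s1 pos1] := info1_psd d.
have [/symmetricmxP s2 pos2] := info2_psd d; split.
  by apply/symmetricmxP; rewrite linearD !linearZ /= s1 s2.
move=> x; rewrite -/(bform _ x x) KU_infoE.
by rewrite addr_ge0 ?mulr_ge0 ?subr_ge0 ?pos1 ?pos2.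
Qed.

(** In the incomparable case this is the non-singularity required of the weight.
    If one information matrix strictly dominates the other, it is definite and
    carries all the weight; if they coincide, both vanish only on the common
    kernel of [H1] and [H2], which is trivial. *)
Lemma KU_info_pd (al : fusion_input R p1 p2 -> R) d :
  KU_weights H1 H2 al -> pdmx (KU_info H1 H2 al d).
Proof.
move=> /(_ d)[a01 a0 a1 aunit]; have Mpsd := KU_info_psd a01.
have pos1 := (info1_psd d).2; have pos2 := (info2_psd d).2.
have [lt12|nlt12] := pselect (loewner_lt (info1 H1 d) (info2 H2 d)).
  split=> [|x x0]; first exact: Mpsd.1.
  rewrite -/(bform _ x x) KU_infoE a0 // mul0r add0r subr0 mul1r.
  have := lt12.2 x x0; rewrite -/(bform _ x x) bformB subr_gt0.
  exact: le_lt_trans (pos1 x).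
have [lt21|nlt21] := pselect (loewner_lt (info2 H2 d) (info1 H1 d)).
  split=> [|x x0]; first exact: Mpsd.1.
  rewrite -/(bform _ x x) KU_infoE a1 // subrr mul0r addr0 mul1r.
  have := lt21.2 x x0; rewrite -/(bform _ x x) bformB subr_gt0.
  exact: le_lt_trans (pos2 x).
have [e12|ne12] := pselect (info2 H2 d = info1 H1 d).
  split=> [|x x0]; first exact: Mpsd.1.
  rewrite -/(bform _ x x) KU_infoE e12 -mulrDl addrC subrK mul1r.
  by have := info_max_gt0 d x0; rewrite e12 maxxx.
by apply: psdmx_unit_pd => //; apply: aunit.
Qed.

(** The two vectors [(u, 0)] and [(0, v)] do not see the cross-covariance, which
    is why convexity gives a bound uniform in [P12]. *)
Lemma block_qform_convex (P1 : 'M[R]_p1) (P12 : 'M[R]_(p1, p2)) (P2 : 'M[R]_p2)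
    t (u : 'cV[R]_p1) (v : 'cV[R]_p2) :
  psdmx (block_mx P1 P12 P12^T P2) -> 0 <= t <= 1 ->
  qform (block_mx P1 P12 P12^T P2) (col_mx (t *: u) ((1 - t) *: v)) <=
  t * qform P1 u + (1 - t) * qform P2 v.
Proof.
move=> Ppsd t01; have := qform_convex (col_mx u 0) (col_mx 0 v) Ppsd t01.
rewrite !scale_col_mx add_col_mx !scaler0 addr0 add0r.
have b0 k l (N : 'M[R]_(k, l)) w : bform N 0 w = 0.
  by rewrite /bform trmx0 !mul0mx mxE.
have b0r k l (N : 'M[R]_(k, l)) w : bform N w 0 = 0.
  by rewrite /bform mulmx0 mxE.
have -> : qform (block_mx P1 P12 P12^T P2) (col_mx u 0) = qform P1 u.
  by rewrite bform_block !b0 !b0r !addr0.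
have -> : qform (block_mx P1 P12 P12^T P2) (col_mx 0 v) = qform P2 v.
  by rewrite bform_block !b0 !b0r !add0r.
by [].
Qed.

(** The scalar factors [al] and [1 - al] of the two gains make [K^T *m y] a convex
    combination to which [block_qform_convex] applies; unbiasedness is the
    identity [invmx M *m M = 1] for the combined information [M]. *)
Lemma KU_rule_fusion_rule (al : fusion_input R p1 p2 -> R) :
  KU_weights H1 H2 al -> fusion_rules H1 H2 (KU_rule H1 H2 al).
Proof.
move=> alK; split=> [d|d|d P1 P12 P2].
- exact: pdmx_inv (KU_info_pd d alK).
- have Mu := pdmx_unit (KU_info_pd d alK).
  rewrite -(mulVmx Mu) [in RHS]/KU_info mulmxDr -!scalemxAr.
  by rewrite /= -!scalemxAl /info1 /info2 !mulmxA.
move=> Pj K Pjpd le1 le2.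
set M := KU_info H1 H2 al d.
have Mpd : pdmx M := KU_info_pd d alK.
have /symmetricmxP Mis := (pdmx_inv Mpd).1.
have Pjs := Pjpd.1.
apply/loewner_leP.
- by apply/symmetricmxP; rewrite !trmx_mul trmxK (symmetricmxP _ Pjs) mulmxA.
- exact: (pdmx_inv Mpd).1.
move=> y; pose w := invmx M *m y.
have /symmetricmxP s1 := (pdmx_inv (Phat1_pd d)).1.
have /symmetricmxP s2 := (pdmx_inv (Phat2_pd d)).1.
pose u := invmx (Phat1 d) *m (H1 *m w); pose v := invmx (Phat2 d) *m (H2 *m w).
have Ky : K^T *m y = col_mx (al d *: u) ((1 - al d) *: v).
  rewrite tr_row_mx mul_col_mx !linearZ /= !trmx_mul !trmxK s1 s2 Mis.
  by rewrite -!scalemxAl -!mulmxA.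
rewrite -[K in K *m Pj]trmxK qform_congr.
rewrite Ky; have [a01 _ _ _] := alK d.
apply: le_trans (block_qform_convex _ _ (pdmx_psd Pjpd) a01) _.
have -> : qform (Phat (KU_rule H1 H2 al) d) y = qform M w by rewrite qform_invmx.
have qu : qform (Phat1 d) u = qform (info1 H1 d) w.
  by rewrite info1E /u qform_invmx //; exact: Phat1_pd.
have qv : qform (Phat2 d) v = qform (info2 H2 d) w.
  by rewrite info2E /v qform_invmx //; exact: Phat2_pd.
have /andP[a0 a1] := a01.
rewrite KU_infoE -qu -qv lerD // ler_wpM2l ?subr_ge0 //.
  exact: loewner_le_qform le1.
exact: loewner_le_qform le2.
Qed.

(** The joint covariance [s *: (z *m z^T) + t *: diag(A, B)] with
    [s = (1 - t) / c] and [z = (z1, z2)].  The rank-one matrix [z *m z^T / c]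
    already satisfies both bounds but is only semidefinite in general; mixing
    in the second part with weight [t] makes it definite and keeps the bounds. *)
Lemma admissible_joint_above_rank1 (A : 'M[R]_p1) (B : 'M[R]_p2)
    (z1 : 'cV[R]_p1) (z2 : 'cV[R]_p2) c t :
  pdmx A -> pdmx B -> 0 < c -> 0 < t < 1 ->
  qform (invmx A) z1 <= c -> qform (invmx B) z2 <= c ->
  exists P1 P12 P2,
    [/\ pdmx (block_mx P1 P12 P12^T P2), loewner_le P1 A, loewner_le P2 B &
        loewner_le (((1 - t) / c) *: (col_mx z1 z2 *m (col_mx z1 z2)^T))
                   (block_mx P1 P12 P12^T P2)].
Proof.
move=> Apd Bpd c0 /andP[t0 t1] z1c z2c.
set s := (1 - t) / c; have s0 : 0 < s by rewrite divr_gt0 ?subr_gt0.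
(* a convex combination of [P] and of [z *m z^T / c], which lies below [P] *)
have blk m (P : 'M[R]_m) (z : 'cV[R]_m) : pdmx P -> qform (invmx P) z <= c ->
    loewner_le (s *: (z *m z^T) + t *: P) P.
  move=> Ppd zc; apply/loewner_leP => [||w]; last 1 first.
  - have /loewner_le_qform := (loewner_le_rank1 z Ppd (ltW c0)).2 zc.
    move=> /(_ w); rewrite bformD !bformZ => /(ler_wpM2l (ltW s0)).
    by rewrite mulrA divfK ?gt_eqF //; lra.
  - apply/symmetricmxP; rewrite linearD !linearZ /= trmx_mul trmxK.
    by rewrite (symmetricmxP _ Ppd.1).
  - exact: Ppd.1.
exists (s *: (z1 *m z1^T) + t *: A), (s *: (z1 *m z2^T)),
  (s *: (z2 *m z2^T) + t *: B).
have -> : block_mx (s *: (z1 *m z1^T) + t *: A) (s *: (z1 *m z2^T))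
    (s *: (z1 *m z2^T))^T (s *: (z2 *m z2^T) + t *: B) =
    s *: (col_mx z1 z2 *m (col_mx z1 z2)^T) + t *: block_mx A 0 0 B.
  rewrite tr_col_mx mul_col_row !scale_block_mx add_block_mx !scaler0 !addr0.
  by rewrite linearZ /= trmx_mul trmxK.
have Dpd := pdmx_block_diag Apd Bpd.
have D0 w := (pdmx_psd Dpd).2 w.
have /symmetricmxP Ds := Dpd.1.
split; [split|exact: blk|exact: blk|split].
- apply/symmetricmxP; rewrite linearD !linearZ /= trmx_mul trmxK.
  by rewrite Ds.
- move=> w w0; rewrite -/(bform _ w w) bformD !bformZ qform_rank1.
  have Dw : 0 < t * qform (block_mx A 0 0 B) w.
    by rewrite mulr_gt0 //; exact: Dpd.2.
  by apply: ltr_wpDl Dw; rewrite mulr_ge0 ?sqr_ge0 // ltW.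
- by apply/symmetricmxP; rewrite addrAC subrr add0r linearZ /= Ds.
- move=> w; rewrite -/(bform _ w w) addrAC subrr add0r bformZ.
  by rewrite mulr_ge0 ?D0 // ltW.
Qed.

(** Conservativeness for the joint covariances of
    [admissible_joint_above_rank1] with [z1 = H1 *m x] and [z2 = H2 *m x], which
    an unbiased gain maps above a multiple of [x *m x^T], and then the limit of
    a vanishing perturbation [t]. *)
Lemma fusion_rule_info_bound r d x : fusion_rules H1 H2 r ->
  qform (invmx (Phat r d)) x <=
  Num.max (qform (info1 H1 d) x) (qform (info2 H2 d) x).
Proof.
move=> [rpd runb rcons].
set c := Num.max _ _.
have [->|x0] := eqVneq x 0.
  by rewrite /bform mulmx0 mxE le_max (info1_psd d).2.
have c0 : 0 < c := info_max_gt0 d x0.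
suff H t : 0 < t -> t < 1 -> (1 - t) * qform (invmx (Phat r d)) x <= c.
  rewrite leNgt; apply/negP => lt_c; set q := qform _ _ in H lt_c.
  have q0 : 0 < q := lt_trans c0 lt_c.
  (* the weight for which [(1 - t) * q] is the midpoint of [c] and [q] *)
  have /H : 0 < (q - c) / (2 * q) by rewrite divr_gt0 ?mulr_gt0 ?subr_gt0.
  have -> : (1 - (q - c) / (2 * q)) * q = (q + c) / 2 by field; rewrite gt_eqF.
  have -> : (q - c) / (2 * q) < 1 by rewrite ltr_pdivrMr ?mulr_gt0 //; lra.
  by move=> /(_ isT); lra.
move=> t0 t1; have t01 : 0 < t < 1 by rewrite t0.
have z1c : qform (invmx (Phat1 d)) (H1 *m x) <= c.
  by rewrite -info1E le_max lexx.
have z2c : qform (invmx (Phat2 d)) (H2 *m x) <= c.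
  by rewrite -info2E le_max lexx orbT.
have [P1 [P12 [P2 [Pjpd le1 le2]]]] :=
  admissible_joint_above_rank1 (Phat1_pd d) (Phat2_pd d) c0 t01 z1c z2c.
have := rcons d P1 P12 P2 Pjpd le1 le2; set K := row_mx _ _ => Kle.
move=> /(loewner_le_congr K)/loewner_le_trans/(_ Kle).
have KHx : K *m col_mx (H1 *m x) (H2 *m x) = x.
  by rewrite mul_row_col !mulmxA -mulmxDl runb mul1mx.
rewrite -scalemxAr -scalemxAl !mulmxA KHx -mulmxA -trmx_mul KHx => xle.
have ct0 : 0 <= c / (1 - t) by rewrite divr_ge0 ?subr_ge0 ?(ltW c0) ?(ltW t1).
suff : loewner_le (x *m x^T) ((c / (1 - t)) *: Phat r d).
  move=> /(loewner_le_rank1 _ (rpd d) ct0).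
  by rewrite ler_pdivlMr ?subr_gt0 // mulrC.
apply/loewner_leP => [||y].
- by apply/symmetricmxP; rewrite trmx_mul trmxK.
- by apply/symmetricmxP; rewrite linearZ /= (symmetricmxP _ (rpd d).1).
have := loewner_le_qform y xle.
rewrite !bformZ -[c / _]invf_div => le_y.
by rewrite mulrC ler_pdivlMr ?divr_gt0 ?subr_gt0 // mulrC.
Qed.

(** The dominating weight differs from [al] at [d] only: the definition of the
    family is pointwise, and [al] provides admissible values elsewhere. *)
Lemma KU_rule_below_fusion_rule r d (al : fusion_input R p1 p2 -> R) :
  fusion_rules H1 H2 r -> KU_weights H1 H2 al ->
  exists2 be, KU_weights H1 H2 be &
    loewner_le (Phat (KU_rule H1 H2 be) d) (Phat r d).
Proof.
move=> rF alK; have rpd : pdmx (Phat r d) by have [] := rF.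
set Q := invmx (Phat r d).
have Qpd : pdmx Q := pdmx_inv rpd.
have s1 := (info1_psd d).1; have s2 := (info2_psd d).1; have Qs := Qpd.1.
have [||x|t t01 tQ] := @yuan_alternative _ _ (info1 H1 d - Q) (info2 H2 d - Q).
- by apply/symmetricmxP; rewrite linearB /= (symmetricmxP _ s1) (symmetricmxP _ Qs).
- by apply/symmetricmxP; rewrite linearB /= (symmetricmxP _ s2) (symmetricmxP _ Qs).
- have := fusion_rule_info_bound d x rF.
  by rewrite !bformB !le_max !subr_ge0.
have {}tQ x : qform Q x <= t * qform (info1 H1 d) x + (1 - t) * qform (info2 H2 d) x.
  by have := tQ x; rewrite bformD !bformZ !bformB; lra.
have /andP[t0 t1] := t01.
(* the weight dictated in the strictly ordered cases is at least as good as [t],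
   since there it turns the combination into the larger matrix *)
have [b [b01 bQ b0 b1]] : exists b, [/\ 0 <= b <= 1,
    forall x, qform Q x <= b * qform (info1 H1 d) x + (1 - b) * qform (info2 H2 d) x,
    loewner_lt (info1 H1 d) (info2 H2 d) -> b = 0 &
    loewner_lt (info2 H2 d) (info1 H1 d) -> b = 1].
  have [_ al0 al1 _] := alK d.
  have [lt12|nlt12] := pselect (loewner_lt (info1 H1 d) (info2 H2 d)).
    exists 0; split=> [|x||lt21] //; first by rewrite lexx ler01.
    - apply: le_trans (tQ x) _; have := (pdmx_psd lt12).2 x.
      by rewrite -/(bform _ x x) bformB; nra.
    (* the given weight [al] witnesses that both orders cannot hold at once *)
    - by rewrite -(al0 lt12) al1.
  have [lt21|nlt21] := pselect (loewner_lt (info2 H2 d) (info1 H1 d)).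
    exists 1; split=> // [|x]; first by rewrite lexx ler01.
    apply: le_trans (tQ x) _; have := (pdmx_psd lt21).2 x.
    by rewrite -/(bform _ x x) bformB; nra.
  by exists t.
pose be d' := if pselect (d' = d) then b else al d'.
have bed : be d = b by rewrite /be; case: pselect.
have Mpd : pdmx (KU_info H1 H2 be d).
  split=> [|x x0]; first by apply: (KU_info_psd _).1; rewrite bed.
  rewrite -/(bform _ x x) KU_infoE bed; apply: lt_le_trans (bQ x).
  exact: Qpd.2.
exists be.
  move=> d'; have [->|d'd] := pselect (d' = d); last first.
    have bed' : be d' = al d' by rewrite /be; case: pselect.
    by have := alK d'; rewrite /KU_info bed'.
  by split; rewrite ?bed // => *; exact: pdmx_unit.
rewrite -[Phat r d]invmxK -/Q; apply: loewner_le_inv => //.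
apply/loewner_leP => // [|x]; first exact: Mpd.1.
by rewrite KU_infoE bed.
Qed.

End Fusion.

Theorem theorem20 (R : realType) (n p1 p2 : nat)
    (n_gt0 : (0 < n)%N) (p1_gt0 : (0 < p1)%N) (p2_gt0 : (0 < p2)%N)
    (p1_le_n : (p1 <= n)%N) (p2_le_n : (p2 <= n)%N)
    (H1 : 'M[R]_(p1, n)) (H2 : 'M[R]_(p2, n))
    (rk_H1 : \rank H1 = p1) (rk_H2 : \rank H2 = p2)
    (rk_H : \rank (col_mx H1 H2) = n)
    (J : 'M[R]_n -> R) (J_isotone : strictly_isotone J)
    (r : linear_fusion_rule R n p1 p2) (r_KU : KU_family H1 H2 r) :
  optimal_over J (KU_family H1 H2) r ->
  optimal_over J (fusion_rules H1 H2) r.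
Proof.
move=> [_ r_opt]; have [al alK alr] := r_KU.
split=> [|r' r'F d]; first by rewrite -alr; exact: KU_rule_fusion_rule.
have [be beK be_le] := KU_rule_below_fusion_rule rk_H d r'F alK.
apply: le_trans (r_opt _ (imageP _ beK) d) _.
have [bepd _ _] := KU_rule_fusion_rule rk_H beK.
have [r'pd _ _] := r'F.
exact: (J_isotone _ _ (bepd d).1 (r'pd d).1).1.
Qed.
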